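(* Let $p$ be a prime and let $a,b\in\mathbb{N}$ be such that $b\mid\frac{p^{ab}-1}{p^a-1}$. For any finite commutative local ring with identity $R$ whose residue field $\mathbb{F}_q$ has size $q=p^{ab}$ we have $$g_R\Big(\tfrac{p^{ab}-1}{b(p^a-1)}\Big)=g_R\Big(\tfrac1b\big(p^{a(b-1)}+\cdots+p^{2a}+p^a+1\big)\Big)=b.\qquad( * )$$ Furthermore, $( * )$ holds (for $p$ prime, $a,b\in\mathbb{N}$ and any such $R$) in the following cases: (a) $b=r$ is a prime different from $p$ and $p^a\equiv1\pmod r$. (b) $b=2r$ with $r$ an odd prime, $p^a$ coprime with $b$ and $p^a\equiv\pm1\pmod r$. (c) $b=rr'$ with $r<r'$ odd primes such that $r\nmid r'-1$ and $p^a\equiv1\pmod{rr'}$. (d) $b=r_1r_2\cdots r_\ell$ with $r_1<r_2<\cdots<r_\ell$ primes different from $p$, with $p^a\equiv1\pmod{r_1}$ and $(p^a)^{b/r_i}\equiv1\pmod{r_i}$ for $i=2,\dots,\ell$. (e) $b=r^t$ with $r$ prime such that $ord_b(p^a)=r^h$ for some $0\le h<t$. (f) $b=r_1^{t_1}\cdots r_\ell^{t_\ell}$ with $r_1<\cdots<r_\ell$ primes different from $p$, where $ord_{r_i^{t_i}}(p^a)=r_i^{h_i}$ with $0\le h_i\le t_i-1$ for all $i$. Conversely, if $( * )$ holds with $b$ as in one of the items (a)–(e), then the condition for $p^a$ stated in the corresponding item holds.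
   Context: The Waring number $g_R(k)$ is the minimum $s\in\mathbb{N}$, if it exists, such that $x_1^k+\cdots+x_s^k=r_0$ has a solution in $R$ for every $r_0\in R$. $ord_b(a)$ denotes the order of $a$ modulo $b$, i.e. the least positive integer $t$ with $a^t\equiv1\pmod b$. The assertion that $( * )$ holds includes that $\frac{p^{ab}-1}{b(p^a-1)}$ is an integer.
   Formalization: In the first assertion, (d), (b) with p^a≡-1 mod r, and (e),(f) when 4|b and p^a≢1 mod 4, g_R=b is asserted only if the Waring number exists (for p=3, a=1, b=4, R=F_81 it does not); integrality of the exponent is kept throughout. *)

(* Defs.v *)
From mathcomp Require Import all_boot all_algebra.
Set Implicit Arguments.
Unset Strict Implicit.
Unset Printing Implicit Defensive.
Import GRing.Theory.

Definition sums_of_powers_cover (R : finComNzRingType) (k s : nat) : Prop :=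
  forall r0 : R, exists x : 'I_s -> R, (\sum_(i < s) x i ^+ k)%R = r0.

(* g_R(k) is a partial function, so it is given by its graph:
   is_waring R k s reads "g_R(k) is defined and equal to s". *)
Definition is_waring (R : finComNzRingType) (k s : nat) : Prop :=
  sums_of_powers_cover R k s
  /\ (forall s' : nat, sums_of_powers_cover R k s' -> s <= s').

Definition waring_exists (R : finComNzRingType) (k : nat) : Prop :=
  exists s : nat, is_waring R k s.

(* idealr_closed contains 1 \notin m, i.e. the ideal is proper. *)
Definition maximal_ideal (R : finComNzRingType) (m : {set R}) : Prop :=
  idealr_closed m
  /\ (forall J : {set R}, idealr_closed J -> m \subset J -> J = m).

Definition local_ring (R : finComNzRingType) (m : {set R}) : Prop :=
  maximal_ideal m /\ (forall J : {set R}, maximal_ideal J -> J = m).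

(* The set of cosets x + m, whose cardinal is that of the residue field R/m. *)
Definition residue_classes (R : finComNzRingType) (m : {set R}) : {set {set R}} :=
  [set [set (x + y)%R | y in m] | x : R].

Definition is_mult_order (n x d : nat) : Prop :=
  [/\ 0 < d, x ^ d = 1 %[mod n]
    & forall e : nat, 0 < e -> x ^ e = 1 %[mod n] -> d <= e].

Definition waring_exponent (p a b : nat) : nat :=
  (p ^ (a * b) - 1) %/ (b * (p ^ a - 1)).

Definition waring_exponent_integral (p a b : nat) : Prop :=
  b * (p ^ a - 1) %| p ^ (a * b) - 1.

Definition star (p a b : nat) (R : finComNzRingType) : Prop :=
  [/\ waring_exponent_integral p a b,
      is_waring R (waring_exponent p a b) b
    & is_waring R ((\sum_(i < b) p ^ (a * i)) %/ b) b].

(* The equation g_R(k) = b with g_R(k) a partial term: it gives the value of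
   g_R(k) when it is defined.  It need not be: for p = 3, a = 1, b = 4 the
   exponent is 10, and the 10th powers in F_81 are the elements of the proper
   subfield F_9, so g_R(10) is undefined for R = F_81, although
   4 %| (3 ^ 4 - 1) %/ (3 - 1) and 3 has order 2 modulo 4.  Likewise for p = 5,
   a = 1, b = 6 the powers generate only F_25 in the field of 5 ^ 6 elements,
   although 5 + 1 = 0 %[mod 3] and 5 ^ 2 = 1 %[mod 3]. *)
Definition star_if_defined (p a b : nat) (R : finComNzRingType) : Prop :=
  waring_exponent_integral p a b
  /\ (waring_exists R (waring_exponent p a b) -> star p a b R).

Definition increasing_primes (l : nat) (r : 'I_l -> nat) : Prop :=
  (forall i, prime (r i)) /\ (forall i j : 'I_l, i < j -> r i < r j).

(* Main.v *)
Require Import Defs.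
From HB Require Import structures.
From mathcomp Require Import all_boot all_algebra all_solvable all_field zify.

(** Write Q = p ^ a, F for the residue field (so #|F| = Q ^ b), N for
    1 + Q + ... + Q ^ (b - 1), and k = N / b.

    The non-zero k-th powers of F form the cyclic group of order b * (Q - 1).
    It contains the units of the subfield K of order Q, and if w generates it
    then it is the union of the b cosets K^* w ^ i, i < b.  Hence a sum of k-th
    powers is the same thing as a combination c_0 + c_1 w + ... + c_(b-1)
    w ^ (b-1) with coefficients in K, each power contributing to one coordinate.
    There are Q ^ b = #|F| tuples of coefficients, so as soon as these
    combinations exhaust F they are also unique ([combination_inj_surj]).  Then
    b powers always suffice, and 1 + w + ... + w ^ (b-1) needs b of them, all its
    coordinates being non-zero: the Waring number of F is b whenever it exists
    ([combination_inj_waring]).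

    It exists when b divides 1 + Q + ... + Q ^ (d-1) only for multiples d of b:
    the conjugates w ^ (Q ^ j), j < b, are then distinct, so w is not a root of
    a non-zero polynomial of degree less than b over K ([combination_inj]).
    When Q = 1 modulo every prime factor of b, and modulo 4 if 4 divides b, this
    divisibility property follows from the valuations of the geometric sums
    ([repunit_dvdn]).

    The passage from F to R is a lifting argument: k is invertible in F because
    N = 1 modulo p, so the k-th power map permutes the elements congruent to 1
    modulo the maximal ideal ([principal_unit_power]), and a sum of k-th powers
    in F that has a non-zero term lifts to R ([lift_sum_powers]).  The residue 0
    also is such a sum when b > 1, because -1 is in K, hence a k-th power.

    So, existence apart, what is to be decided is whether b divides N, and the
    remaining items are elementary congruences.  If b divides N then Q ^ b = 1
    modulo b, and Fermat's little theorem together with coprimality of exponents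
    lowers the exponent b.  Conversely b divides N when Q = 1 modulo every prime
    factor of b ([dvdn_repunit]), and a single prime factor r of b divides N when
    Q ^ b = 1 modulo r ([prime_dvd_repunit]). *)

Import GRing.Theory.
Set Implicit Arguments.
Unset Strict Implicit.
Unset Printing Implicit Defensive.

(** * Geometric sums and congruences *)

Definition repunit (Q n : nat) : nat := \sum_(i < n) Q ^ i.

Lemma expn_sub1 Q n : Q ^ n - 1 = (Q - 1) * repunit Q n.
Proof. by rewrite !subn1 predn_exp. Qed.

Lemma repunitM Q m n : 1 < Q ->
  repunit Q (m * n) = repunit Q m * repunit (Q ^ m) n.
Proof.
move=> Q1; apply/eqP; rewrite -(@eqn_pmul2l (Q - 1)) ?subn_gt0 //.
by rewrite mulnA -!expn_sub1 expnM.
Qed.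

Lemma expn_mod1 x n d : x = 1 %[mod d] -> x ^ n = 1 %[mod d].
Proof. by move=> x1; rewrite -modnXm x1 modnXm exp1n. Qed.

Lemma repunit_mod1 Q n d : Q = 1 %[mod d] -> repunit Q n = n %[mod d].
Proof.
move=> Q1; rewrite /repunit -modn_summ.
under eq_bigr do rewrite (expn_mod1 _ Q1).
by rewrite modn_summ sum1_card card_ord.
Qed.

Lemma coprime_repunit Q n : 0 < n -> coprime Q (repunit Q n).
Proof.
case: n => // n _; rewrite /repunit big_ord_recl.
under eq_bigr do rewrite expnS.
by rewrite -big_distrr /= addnC mulnC /coprime gcdnMDl gcdn1.
Qed.

(** Peel off the smallest prime factor r of b = r * c: the sum of length b is
    the sum of length r, which is r = 0 modulo r, times the sum of length c in
    base Q ^ r, to which induction applies. *)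
Lemma dvdn_repunit Q b : 1 < Q -> 0 < b ->
  (forall r, prime r -> r %| b -> Q = 1 %[mod r]) -> b %| repunit Q b.
Proof.
elim/ltn_ind: b Q => b IH Q Q1 b0 Qr.
have [->|b1] := eqVneq b 1; first exact: dvd1n.
have r_pr : prime (pdiv b) by rewrite pdiv_prime; lia.
set r := pdiv b in r_pr.
have /dvdnP[c bE] : r %| b := pdiv_dvd b.
have c0 : 0 < c by move: b0; rewrite bE muln_gt0 => /andP[].
have r1 := prime_gt1 r_pr.
rewrite {2}bE mulnC repunitM // bE mulnC dvdn_mul //.
  by rewrite /dvdn repunit_mod1 ?modnn //; apply: Qr; rewrite // bE dvdn_mull.
apply: IH => //.
- by rewrite bE ltn_Pmulr.
- by rewrite -(exp1n r) ltn_exp2r // prime_gt0.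
by move=> s s_pr sc; apply: expn_mod1; apply: Qr; rewrite // bE dvdn_mulr.
Qed.

(** With Q = 1 + r * y the sum is r + r * y * 'C(r, 2) modulo r * r, and r
    divides 'C(r, 2) when r is odd.  For r = 2 the sum is Q + 1 = 2 modulo 4. *)
Lemma sqr_ndvd_repunit Q r : 0 < Q -> prime r -> Q = 1 %[mod r] ->
  (r = 2 -> Q = 1 %[mod 4]) -> ~~ (r * r %| repunit Q r).
Proof.
move=> Q0 r_pr Q1 Q4; have [r2|r_odd] := even_prime r_pr.
  rewrite r2 /repunit 2!big_ord_recl big_ord0 /= expn0 expn1.
  by have := Q4 r2; lia.
have /dvdnP[y Qy] : r %| Q - 1 by rewrite -eqn_mod_dvd //; apply/eqP.
have {Qy Q1} QE : Q = 1 + r * y by lia.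
have pow_mod i : Q ^ i = 1 + i * (r * y) %[mod r * r].
  elim: i => [|i IHi] //; rewrite expnS -modnMmr IHi modnMmr QE.
  have -> : (1 + r * y) * (1 + i * (r * y)) =
            i * y * y * (r * r) + (1 + i.+1 * (r * y)) by lia.
  exact: modnMDl.
have r2 : 2 < r by have := prime_gt1 r_pr; case: (r) r_odd => [|[|[|]]].
have /dvdnP[h hE] : r %| 'C(r, 2) by apply: prime_dvd_bin.
have -> : r * r %| repunit Q r = (r * r %| r).
  rewrite /dvdn /repunit -modn_summ; under eq_bigr do rewrite pow_mod.
  rewrite modn_summ big_split /= sum1_card card_ord -big_distrl /=.
  rewrite (_ : \sum_(i < r) i = 'C(r, 2)); last first.
    by rewrite -bin2_sum big_mkord.
  rewrite hE (_ : h * r * (r * y) = h * y * (r * r)); last by lia.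
  by rewrite [r + _]addnC modnMDl.
by apply/negP => /dvdn_leq; nia.
Qed.

(** A form of lifting the exponent, again by peeling off a prime factor r of
    b = r * c.  As r divides d as well, write d = r * e: the sum of length r is
    r * u with u coprime to c, so c divides the sum of length e in base Q ^ r.
    The condition modulo 4 is what makes u odd when r = 2 divides c. *)
Lemma repunit_dvdn Q b d : 1 < Q -> 0 < b ->
  (forall r, prime r -> r %| b -> Q = 1 %[mod r]) ->
  (4 %| b -> Q = 1 %[mod 4]) -> b %| repunit Q d -> b %| d.
Proof.
elim/ltn_ind: b Q d => b IH Q d Q1 b0 Qr Q4 b_d.
have [->|b1] := eqVneq b 1; first exact: dvd1n.
have r_pr : prime (pdiv b) by rewrite pdiv_prime; lia.
set r := pdiv b in r_pr.
have /dvdnP[c bE] : r %| b := pdiv_dvd b.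
have c0 : 0 < c by move: b0; rewrite bE muln_gt0 => /andP[].
have r1 := prime_gt1 r_pr.
have rb : r %| b by rewrite bE dvdn_mull.
have /dvdnP[e dE] : r %| d.
  by rewrite /dvdn -(repunit_mod1 d (Qr r r_pr rb)); apply: dvdn_trans b_d.
have /dvdnP[u uE] : r %| repunit Q r.
  by rewrite /dvdn (repunit_mod1 r (Qr r r_pr rb)) modnn.
(* A common prime s of c and u divides b, so the sum of length r is r modulo
   s; this forces s = r, which is excluded since the sum is not divisible by
   r * r. *)
have cu : coprime c u.
  rewrite /coprime; apply/negP => /negP cu.
  have s_pr : prime (pdiv (gcdn c u)).
    by rewrite pdiv_prime // ltn_neqAle eq_sym cu gcdn_gt0 c0.
  set s := pdiv _ in s_pr.
  have /andP[sc su] : (s %| c) && (s %| u) by rewrite -dvdn_gcd pdiv_dvd.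
  have sb : s %| b by rewrite bE dvdn_mulr.
  have sr : s = r.
    apply/eqP; rewrite -dvdn_prime2 // /dvdn -(repunit_mod1 r (Qr s s_pr sb)).
    by rewrite uE; apply: dvdn_mulr.
  rewrite sr in sc su.
  have := sqr_ndvd_repunit (ltnW Q1) r_pr (Qr r r_pr rb).
  rewrite uE dvdn_mul // => /(_ _)/negP; apply=> // r2.
  by apply: Q4; rewrite bE -[4]/(2 * 2) -r2 dvdn_mul.
rewrite dE bE dvdn_pmul2r ?prime_gt0 //.
apply: (IH c _ (Q ^ r)) => //.
- by rewrite bE ltn_Pmulr.
- by rewrite -(exp1n r) ltn_exp2r // prime_gt0.
- by move=> s s_pr sc; apply: expn_mod1; apply: Qr; rewrite // bE dvdn_mulr.
- by move=> c4; apply: expn_mod1; apply: Q4; rewrite bE dvdn_mulr.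
move: b_d; rewrite dE [e * r]mulnC repunitM // uE bE -mulnA mulnCA mulnC.
by rewrite dvdn_pmul2l ?prime_gt0 // Gauss_dvdr.
Qed.

Lemma expn_gcd_mod1 x m n d : 0 < m ->
  x ^ m = 1 %[mod d] -> x ^ n = 1 %[mod d] -> x ^ gcdn m n = 1 %[mod d].
Proof.
move=> m0 xm xn; case: (egcdnP n m0) => u v uv _.
rewrite -[x ^ _]mul1n -modnMml -(expn_mod1 v xn) modnMml -expnM -expnD.
rewrite [n * v]mulnC -uv mulnC expnM (expn_mod1 u xm).
by rewrite mulnC expnM (expn_mod1 v xn).
Qed.

Lemma expn_coprime_mod1 x m r : prime r -> 0 < m -> coprime m (r - 1) ->
  x ^ m = 1 %[mod r] -> x = 1 %[mod r].
Proof.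
move=> r_pr m0 /eqP m_cop xm.
have := @expn_gcd_mod1 x m (r - 1) r m0 xm; rewrite m_cop expn1; apply.
have xr : coprime x r.
  rewrite coprime_sym prime_coprime //; apply/negP => rx.
  have : r %| x ^ m by rewrite (dvdn_trans rx) // dvdn_exp.
  by rewrite /dvdn xm modn_small ?prime_gt1.
by have := Euler_exp_totient xr; rewrite totient_prime // subn1.
Qed.

(** * The residue field of a finite local ring *)

Section ResidueField.
Local Open Scope ring_scope.

(** In a finite ring every proper ideal lies in a maximal one, so the principal
    ideal of a non-unit lies in the unique maximal ideal. *)
Lemma local_ring_unit (R : finComNzRingType) (m : {set R}) (x : R) :
  local_ring m -> x \notin m -> exists y, x * y = 1.
Proof.
move=> [_ m_uniq] xNm.
case: (boolP [exists y, x * y == 1]) => [/existsP[y /eqP xy]|/existsPn x_nu].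
  by exists y.
pose ideal (J : {set R}) :=
  [&& 0 \in J, 1 \notin J &
      [forall a, forall u in J, forall v in J, a * u + v \in J]].
have idealP (J : {set R}) : reflect (idealr_closed J) (ideal J).
  apply: (iffP and3P) => [[J0 J1 JD]|[J0 J1 JD]]; split=> //.
    move=> a u v uJ vJ.
    by move/forallP/(_ a)/forall_inP/(_ u uJ)/forall_inP/(_ v vJ): JD.
  by apply/forallP => a; apply/forall_inP => u uJ; apply/forall_inP => v vJ;
     apply: JD.
pose xR := [set x * y | y : R].
have xxR : x \in xR by apply/imsetP; exists 1; rewrite ?mulr1.
have xR_ideal : ideal xR.
  apply/idealP; split.
  - by apply/imsetP; exists 0; rewrite ?mulr0.
  - by apply/imsetP => -[y _ xy]; case/negP: (x_nu y); rewrite -xy.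
  move=> a _ _ /imsetP[u _ ->] /imsetP[v _ ->].
  by apply/imsetP; exists (a * u + v); rewrite // mulrDr mulrCA.
have [J /maxsetP[/idealP J_ideal J_max] xR_J] := maxset_exists xR_ideal.
case/negP: xNm; rewrite -(m_uniq J) ?(subsetP xR_J) //.
by split=> // K /idealP; apply: J_max.
Qed.

(** The quotient by m is presented by its projection, whose target carries the
    field and finite structures directly, so that congruences modulo m become
    equations in F and non-zero images detect the units of R. *)
Lemma residue_field (R : finComNzRingType) (m : {set R}) :
  local_ring m ->
  exists (F : finFieldType) (pi : {rmorphism R -> F}),
    [/\ forall z, exists x, pi x = z,
        forall x, pi x != 0 -> exists y, x * y = 1
      & #|F| = #|residue_classes m|].
Proof.
move=> m_local; have [[mI _] _] := m_local.
pose I : idealr R :=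
  HB.pack (fun x : R => x \in m) (isIdealr.Build R (fun x => x \in m) mI).
pose Q : comNzRingType := {ideal_quot I}.
pose pi : {rmorphism R -> Q} := @generic_quotient.pi _ Q.
have pi_surj z : exists x, pi x = z.
  by exists (generic_quotient.repr z); rewrite /pi /= generic_quotient.reprK.
have pi_eq x y : (pi x == pi y) = (x - y \in m).
  by rewrite -[RHS]/(x - y \in (I : {pred R})) Quotient.idealrBE.
have pi_unit x : pi x != 0 -> exists y, x * y = 1.
  move=> x0; apply: (local_ring_unit m_local).
  by rewrite -[x]subr0 -pi_eq rmorph0.
have Q_unit (z : Q) : exists y : Q, if z == 0 then y == 0 else y * z == 1.
  have [x <-] := pi_surj z; have [_|x0] := boolP (pi x == 0).
    by exists 0.
  have [y xy] := pi_unit x x0.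
  by exists (pi y); rewrite mulrC -rmorphM xy rmorph1.
have [inv invP] : {inv : Q -> Q |
    forall z, if z == 0 then inv z == 0 else inv z * z == 1}.
  by exists (fun z => xchoose (Q_unit z)) => z; apply: xchooseP (Q_unit z).
have mulVf z : z != 0 -> inv z * z = 1.
  by move=> z0; have := invP z; rewrite (negPf z0) => /eqP.
have invr0 : inv 0 = 0 by have := invP 0; rewrite eqxx => /eqP.
pose F : finFieldType := HB.pack Q
  (CanIsCountable (@generic_quotient.reprK _ Q))
  (CanIsFinite (@generic_quotient.reprK _ Q))
  (GRing.ComNzRing_isField.Build Q mulVf invr0).
exists F, (pi : {rmorphism R -> F}); split=> //.
pose fiber (z : F) := [set x | (pi x : F) == z].
have fiberE x : fiber (pi x) = [set x + y | y in m].
  apply/setP => u; rewrite inE (pi_eq u x); apply/idP/imsetP=> [ux|[y ym ->]].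
    by exists (u - x); rewrite // addrC subrK.
  by rewrite addrC addKr.
rewrite -cardsT -(@card_imset _ _ fiber) => [|z z'].
  congr #|pred_of_set _|; apply/setP => A; apply/imsetP/imsetP => -[z _ ->].
    by have [x <-] := pi_surj z; exists x.
  by exists (pi z).
have [x <-] := pi_surj z => eq_fib.
have: x \in fiber z' by rewrite -eq_fib inE eqxx.
by rewrite inE => /eqP.
Qed.

End ResidueField.

(** * Sums of k-th powers in the residue field *)

Section FieldWaring.
Local Open Scope ring_scope.

Lemma finField_prim_root (F : finFieldType) :
  exists g : F, (#|F| - 1).-primitive_root g.
Proof.
have F1 := finNzRing_gt1 F.
have /hasP[g _ g_prim] : has (#|F| - 1).-primitive_root (enum (predC1 (0 : F))).
  apply: has_prim_root; rewrite ?subn_gt0 ?enum_uniq //.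
    apply/allP => x; rewrite mem_enum /= => x0; rewrite unity_rootE.
    apply/eqP/(mulfI x0).
    by rewrite -exprS subn1 (ltn_predK F1) expf_card mulr1.
  by rewrite -cardE cardC1 subn1.
by exists g.
Qed.

Variables (F : finFieldType) (p a b k : nat).
Let Q := (p ^ a)%N.
Hypotheses (p_pr : prime p) (a_gt0 : (0 < a)%N) (b_gt0 : (0 < b)%N).
Hypothesis cardF : #|F| = (Q ^ b)%N.
Hypothesis bk : repunit Q b = (b * k)%N.

Let Q_gt1 : (1 < Q)%N.
Proof. by rewrite /Q -(exp1n a) ltn_exp2r ?prime_gt1. Qed.

Lemma residue_pchar : p \in [pchar F].
Proof. by apply: (@card_finPcharP _ p (a * b)); rewrite // cardF expnM. Qed.

Lemma exprD_frob (j : nat) (x y : F) :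
  (x + y) ^+ (Q ^ j) = x ^+ (Q ^ j) + y ^+ (Q ^ j).
Proof.
by apply: exprDn_pchar; rewrite !pnatX pnatE // residue_pchar.
Qed.

Lemma expr_frob_inj (j : nat) : injective (fun x : F => x ^+ (Q ^ j)).
Proof.
move=> x y /= xy; apply/eqP; rewrite -subr_eq0.
have: (x - y) ^+ (Q ^ j) == 0.
  by rewrite -(inj_eq (addIr (y ^+ (Q ^ j)))) -exprD_frob subrK add0r xy.
by rewrite expf_eq0 => /andP[].
Qed.

(** This is the subfield of F with Q elements. *)
Definition fixed_subfield : {set F} := [set x | x ^+ Q == x].
Local Notation K := fixed_subfield.

Lemma fixed_subfieldX j c : c \in K -> c ^+ (Q ^ j) = c.
Proof.
rewrite inE => /eqP cK; elim: j => [|j IHj]; first by rewrite expr1.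
by rewrite expnS exprM cK.
Qed.

Lemma fixed_subfield0 : 0 \in K.
Proof. by rewrite inE expr0n eqn0Ngt ltnW. Qed.

Lemma fixed_subfield1 : 1 \in K.
Proof. by rewrite inE expr1n. Qed.

Lemma fixed_subfieldB x y : x \in K -> y \in K -> x - y \in K.
Proof.
rewrite !inE => /eqP xK /eqP yK.
rewrite -(inj_eq (addIr y)) subrK -{2}yK -[Q]expn1 -exprD_frob subrK expn1.
exact/eqP.
Qed.

Lemma fixed_subfield_sum (I : finType) (P : pred I) (f : I -> F) :
  (forall i, f i \in K) -> \sum_(i | P i) f i \in K.
Proof.
move=> fK; elim/big_ind: _ => // [|x y xK yK]; first exact: fixed_subfield0.
rewrite -[y]opprK fixed_subfieldB // -sub0r fixed_subfieldB //.
exact: fixed_subfield0.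
Qed.

(** The facts used about a generator w of the group of non-zero k-th powers:
    the k-th powers are the c * w ^+ i with c in K, the exponents i < b being
    enough because w ^+ b is in K; and the order of w is b * (Q - 1), expressed
    through w ^+ e.+1 = w because it is applied to conjugates of w. *)
Definition power_generator (w : F) :=
  [/\ forall c i, c \in K -> exists y, y ^+ k = c * w ^+ i,
      forall y, exists c, exists2 i : 'I_b, c \in K & y ^+ k = c * w ^+ i
    & forall e, w ^+ e.+1 = w -> (b * (Q - 1) %| e)%N].

(** A primitive root g of F gives everything: k * b = N divides the order of
    F^*, the powers of g ^+ N are the units of K, and w = g ^+ k. *)
Lemma fixed_subfield_card_generator :
  #|K| = Q /\ exists w, power_generator w.
Proof.
have [g g_prim] := finField_prim_root F.
have Q1 : (0 < Q - 1)%N by rewrite subn_gt0.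
have FE : (#|F| - 1 = b * k * (Q - 1))%N.
  by rewrite cardF expn_sub1 bk mulnC.
have bk0 : (0 < b * k)%N.
  have := prim_order_gt0 g_prim; rewrite FE; lia.
have k0 : (0 < k)%N by move: bk0; rewrite muln_gt0 => /andP[].
have gbk : (Q - 1).-primitive_root (g ^+ (b * k)).
  have := exp_prim_root g_prim (b * k).
  by rewrite FE gcdnMr mulKn.
have gk : (b * (Q - 1)).-primitive_root (g ^+ k).
  have := exp_prim_root g_prim k.
  by rewrite FE [(b * k)%N]mulnC -mulnA gcdnMr mulKn.
have KE c : (c \in K) = (c == 0) || (c ^+ (Q - 1) == 1).
  rewrite inE -[X in c ^+ X](subnK (ltnW Q_gt1)) addn1 exprS.
  by rewrite -[X in _ == X]mulr1 -subr_eq0 -mulrBr mulf_eq0 subr_eq0.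
have powK c : c \in K -> c != 0 -> exists j, c = g ^+ (b * k * j).
  rewrite KE => /orP[->//|/eqP c1] _.
  by have [j ->] := prim_rootP gbk c1; exists j; rewrite -exprM.
have Kpow j : g ^+ (b * k * j) \in K.
  rewrite KE -exprM (_ : b * k * j * (Q - 1) = (#|F| - 1) * j)%N; last first.
    by rewrite FE mulnAC.
  rewrite [g ^+ ((#|F| - 1) * j)]exprM (prim_expr_order g_prim) expr1n.
  by rewrite eqxx orbT.
split.
  move: (g ^+ (b * k)) gbk => z z_prim.
  have -> : K = 0 |: [set z ^+ i | i : 'I_(Q - 1)].
    apply/setP => c; rewrite KE !inE; case: eqVneq => //= c0.
    apply/eqP/imsetP => [/(prim_rootP z_prim)[i ->]|[i _ ->]].
      by exists i.
    by rewrite exprAC (prim_expr_order z_prim) expr1n.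
  rewrite cardsU1 card_imset ?card_ord.
    case: imsetP => [[i _ z0]|_]; last by rewrite add1n; lia.
    have := prim_expr_order z_prim; move/eqP: z0; rewrite eq_sym expf_eq0.
    case/andP=> _ /eqP ->; rewrite expr0n eqn0Ngt Q1 => /eqP.
    by rewrite eq_sym oner_eq0.
  move=> i j /eqP; rewrite (eq_prim_root_expr z_prim) !modn_small //.
  by move/eqP/val_inj.
exists (g ^+ k); split.
- move=> c i cK; have [->|c0] := eqVneq c 0.
    by exists 0; rewrite mul0r expr0n eqn0Ngt k0.
  have [j ->] := powK c cK c0; exists (g ^+ (b * j + i)).
  by rewrite -!exprM -exprD; congr (g ^+ _); lia.
- move=> y; have [->|y0] := eqVneq y 0.
    exists 0, (Ordinal b_gt0); first exact: fixed_subfield0.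
    by rewrite mul0r expr0n eqn0Ngt k0.
  have y1 : y ^+ (#|F| - 1) = 1.
    apply: (mulfI y0); rewrite -exprS subn1 (ltn_predK (finNzRing_gt1 F)).
    by rewrite expf_card mulr1.
  have [j ->] := prim_rootP g_prim y1.
  exists (g ^+ (b * k * (j %/ b))), (Ordinal (ltn_pmod j b_gt0)) => //=.
  rewrite -!exprM -exprD; congr (g ^+ _).
  rewrite {1}(divn_eq j b); lia.
move=> e /eqP; rewrite -[X in _ == X]expr1 (eq_prim_root_expr gk).
by rewrite eqn_mod_dvd // subSS subn0.
Qed.

Section Coordinates.

Variable w : F.
Hypothesis w_gen : power_generator w.

Definition coordinates : {set {ffun 'I_b -> F}} := [set c in ffun_on (mem K)].
Local Notation A := coordinates.

Definition combination (c : {ffun 'I_b -> F}) : F := \sum_i c i * w ^+ i.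

Lemma coordinatesP (c : {ffun 'I_b -> F}) :
  reflect (forall i, c i \in K) (c \in A).
Proof. by rewrite inE; apply: ffun_onP. Qed.

Lemma card_coordinates : #|A| = #|F|.
Proof.
rewrite cardsE card_ffun_on card_ord cardF.
by have [-> _] := fixed_subfield_card_generator.
Qed.

(** Both properties say that the image of A has #|F| = Q ^ b elements, since A
    itself has that many. *)
Lemma combination_inj_surj :
  {in A &, injective combination} <->
  (forall z, exists2 c, c \in A & z = combination c).
Proof.
split=> [/imset_injP /eqP img z|surj].
  apply/imsetP; have -> : combination @: A = setT; last by rewrite inE.
  by apply/eqP; rewrite eqEcard subsetT cardsT img card_coordinates /=.
apply/imset_injP; rewrite card_coordinates -cardsT.
apply/eqP; congr #|pred_of_set _|; apply/setP => z; rewrite inE.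
by apply/imsetP.
Qed.

(** Every power is c * w ^+ i for one i; collecting the terms with the same i
    gives the coordinates, and fewer than b terms leave some i unused. *)
Lemma sum_powers_combination s (x : 'I_s -> F) :
  exists c, [/\ c \in A, \sum_j x j ^+ k = combination c
             & (s < b)%N -> exists i, c i = 0].
Proof.
have [_ pow _] := w_gen.
have /fin_all_exists[f fP] j : exists ci : F * 'I_b,
    ci.1 \in K /\ x j ^+ k = ci.1 * w ^+ ci.2.
  by have [c [i cK yE]] := pow (x j); exists (c, i).
exists [ffun i => \sum_(j | (f j).2 == i) (f j).1]; split.
- apply/coordinatesP => i; rewrite ffunE; apply: fixed_subfield_sum => j.
  by have [] := fP j.
- rewrite (partition_big (fun j => (f j).2) xpredT) //=.
  apply: eq_bigr => i _; rewrite ffunE mulr_suml.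
  by apply: eq_bigr => j /eqP <-; have [] := fP j.
move=> sb.
have /subsetPn[i _ iNf] : ~~ ([set: 'I_b] \subset [set (f j).2 | j : 'I_s]).
  apply/negP => /subset_leq_card; rewrite cardsT card_ord leqNgt => /negP[].
  by apply: leq_ltn_trans sb; rewrite -[s in (_ <= s)%N]card_ord leq_imset_card.
exists i; rewrite ffunE big_pred0 // => j; apply/negP => /eqP fj.
by case/negP: iNf; apply/imsetP; exists j.
Qed.

(** The difference of two combinations with the same value is a polynomial over
    K of degree less than b with root w.  Its roots are stable under
    x |-> x ^+ Q, and the hypothesis makes the b conjugates of w distinct: if
    w ^+ (Q ^ e) = w then b * (Q - 1) divides Q ^ e - 1, so b divides the
    geometric sum of length e, hence e. *)
Lemma combination_inj :
  (forall d, (b %| repunit Q d -> b %| d)%N) -> {in A &, injective combination}.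
Proof.
move=> b_order c c' cA c'A cc'.
pose d i := c i - c' i.
have dK i : d i \in K.
  by apply: fixed_subfieldB; [move/coordinatesP: cA | move/coordinatesP: c'A].
(* The default value 0 is never reached, as \poly_(i < b) only uses i < b. *)
pose P : {poly F} := \poly_(i < b) oapp d 0 (insub i).
have coefP (i : 'I_b) : P`_i = d i by rewrite coef_poly ltn_ord valK.
have w_root : \sum_i d i * w ^+ i = 0.
  rewrite -[RHS](subrr (combination c)) {2}cc' -sumrB.
  by apply: eq_bigr => i _; rewrite -mulrBl.
have P_root j : root P (w ^+ (Q ^ j)).
  have frob0 : (0 : F) ^+ (Q ^ j) = 0 by rewrite expr0n expn_eq0 eqn0Ngt ltnW.
  rewrite /root horner_poly -[X in _ == X]frob0 -[X in _ == X ^+ _]w_root.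
  rewrite (big_morph _ (exprD_frob j) frob0).
  apply/eqP/eq_bigr => i _.
  by rewrite valK /= exprMn (fixed_subfieldX _ (dK i)) [LHS]mulrC exprAC mulrC. 
pose conj := [seq w ^+ (Q ^ j) | j <- iota 0 b].
have conj_uniq : uniq conj.
  rewrite map_inj_in_uniq ?iota_uniq //.
  have conj_lt i j : (i < j < b)%N -> w ^+ (Q ^ i) <> w ^+ (Q ^ j).
    case/andP=> ij jb wij.
    have w_ji : w ^+ (Q ^ (j - i)) = w.
      by apply: (@expr_frob_inj i); rewrite -exprM -expnD subnK // ltnW.
    have [_ _ /(_ (Q ^ (j - i) - 1)%N)] := w_gen.
    have Qji : (0 < Q ^ (j - i))%N by rewrite expn_gt0 ltnW.
    rewrite -addn1 subnK // expn_sub1.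
    rewrite [(b * _)%N]mulnC dvdn_pmul2l ?subn_gt0 // => /(_ w_ji)/b_order.
    by move/dvdn_leq; lia.
  move=> i j; rewrite !mem_iota !add0n /= => ib jb wij.
  by case: (ltngtP i j) => // ij; [case: (@conj_lt i j) | case: (@conj_lt j i)];
     rewrite ?ij.
have P0 : P = 0.
  apply/eqP; apply: contraT => P_neq0.
  have := max_poly_roots P_neq0 _ conj_uniq; rewrite size_map size_iota.
  move=> /(_ _)/leq_trans/(_ (size_poly _ _)); rewrite ltnn; apply.
  by apply/allP => _ /mapP[j _ ->].
by apply/ffunP => i; apply/eqP; rewrite -subr_eq0 -/(d i) -coefP P0 coef0.
Qed.

(** For the lower bound, 1 + w + ... + w ^ (b-1) has no vanishing coordinate,
    while a sum of fewer than b powers has one. *)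
Lemma combination_inj_waring :
  {in A &, injective combination} -> is_waring F k b.
Proof.
move=> comb_inj; split.
  have [pow _ _] := w_gen => z.
  have [c /coordinatesP cA ->] := combination_inj_surj.1 comb_inj z.
  have /fin_all_exists[x xE] i : exists y, y ^+ k = c i * w ^+ i by apply: pow.
  by exists x; apply: eq_bigr.
move=> s cov; rewrite leqNgt; apply/negP => sb.
have [x xE] := cov (combination [ffun=> 1]).
have [c [cA]] := sum_powers_combination x; rewrite xE => c1 /(_ sb)[i ci].
have /ffunP/(_ i) : [ffun=> 1] = c.
  apply: comb_inj => //; apply/coordinatesP => j; rewrite ffunE.
  exact: fixed_subfield1.
by rewrite ffunE ci => /eqP; rewrite oner_eq0.
Qed.

End Coordinates.

Lemma field_waring :
  (exists s, sums_of_powers_cover F k s) \/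
  (forall d, (b %| repunit Q d -> b %| d)%N) ->
  is_waring F k b.
Proof.
have [_ [w w_gen]] := fixed_subfield_card_generator.
case=> [[s cov]|b_order]; apply: (combination_inj_waring w_gen).
  apply/combination_inj_surj => z; have [x <-] := cov z.
  by have [c [cA -> _]] := sum_powers_combination w_gen x; exists c.
exact: combination_inj.
Qed.

Lemma opp1_power : exists z : F, z ^+ k = - 1.
Proof.
have [_ [w [pow _ _]]] := fixed_subfield_card_generator.
have [|z zE] := pow (- 1) 0%N; last by exists z; rewrite zE mulr1.
by rewrite -sub0r fixed_subfieldB ?fixed_subfield0 ?fixed_subfield1.
Qed.

(** k divides N, and N = 1 modulo p. *)
Lemma power_exponent_neq0 : k%:R != 0 :> F.
Proof.
rewrite -(dvdn_pcharf residue_pchar); apply/negP => pk.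
have /eqP p_gcd := coprime_repunit Q b_gt0.
have : (p %| gcdn Q (repunit Q b))%N.
  by rewrite dvdn_gcd bk dvdn_mull // dvdn_exp.
by rewrite p_gcd dvdn1; case: eqP p_pr => // ->.
Qed.

End FieldWaring.

(** * Lifting from the residue field to the local ring *)

Section Lifting.
Local Open Scope ring_scope.

Variables (R : finComNzRingType) (F : finFieldType) (pi : {rmorphism R -> F}).
Hypothesis pi_surj : forall z, exists x, pi x = z.
Hypothesis pi_unit : forall x, pi x != 0 -> exists y, x * y = 1.

Variable k : nat.
Hypothesis k_neq0 : k%:R != 0 :> F.

(** On the finite set of elements congruent to 1 the k-th power map is
    injective, hence onto: u ^+ k - v ^+ k is u - v times a sum whose residue is k, and
    that sum is a unit. *)
Lemma principal_unit_power x : pi x = 1 -> exists v, v ^+ k = x.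
Proof.
move=> x1; pose U := [set u | pi u == 1].
have powU : (fun u : R => u ^+ k) @: U \subset U.
  apply/subsetP => _ /imsetP[u + ->].
  by rewrite !inE => /eqP u1; rewrite rmorphXn /= u1 expr1n.
have pow_inj : {in U &, injective (fun u : R => u ^+ k)}.
  move=> u v /[!inE] /eqP u1 /eqP v1 /eqP; rewrite -subr_eq0 subrXX => /eqP uv.
  have [|y] := pi_unit (x := \sum_(i < k) u ^+ (k.-1 - i) * v ^+ i).
    rewrite rmorph_sum (eq_bigr (fun=> 1)) ?sumr_const ?card_ord // => i _.
    by rewrite rmorphM !rmorphXn u1 v1 !expr1n mulr1.
  move/(congr1 ( *%R (u - v))); rewrite mulrA uv mul0r mulr1 => uv0.
  by apply/eqP; rewrite -subr_eq0 -uv0.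
have /eqP powUE : (fun u : R => u ^+ k) @: U == U.
  by rewrite eqEcard powU (card_in_imset pow_inj) leqnn.
have : x \in U by rewrite inE x1.
by rewrite -powUE => /imsetP[v _ ->]; exists v.
Qed.

(** Lift all terms arbitrarily and correct the error at the term i0, whose lift
    is a unit: the correcting factor has residue 1, so it is a k-th power. *)
Lemma lift_sum_powers s (x : 'I_s -> F) (r : R) (i0 : 'I_s) :
  x i0 != 0 -> \sum_i x i ^+ k = pi r ->
  exists y : 'I_s -> R, \sum_i y i ^+ k = r.
Proof.
move=> xi0 xr.
have /fin_all_exists[y yx] i : exists y, pi y = x i by apply: pi_surj.
have [t yt] : exists t, y i0 * t = 1 by apply: pi_unit; rewrite yx.
have pi_t : x i0 * pi t = 1 by rewrite -yx -rmorphM yt rmorph1.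
have [v vE] : exists v, v ^+ k = (r - \sum_(i | i != i0) y i ^+ k) * t ^+ k.
  apply: principal_unit_power; rewrite rmorphM rmorphB rmorph_sum -xr.
  under [X in _ - X]eq_bigr do rewrite rmorphXn /= yx.
  by rewrite (bigD1 i0) //= addrK rmorphXn -exprMn pi_t expr1n.
exists (fun i => if i == i0 then y i0 * v else y i).
rewrite (bigD1 i0) //= eqxx (eq_bigr (fun i => y i ^+ k)) => [|i /negPf -> //].
by rewrite exprMn vE mulrCA -exprMn yt expr1n mulr1 subrK.
Qed.

Lemma cover_residue s :
  sums_of_powers_cover R k s -> sums_of_powers_cover F k s.
Proof.
move=> cov z; have [r <-] := pi_surj z; have [x <-] := cov r.
exists (fun i => pi (x i)); rewrite rmorph_sum.
by apply: eq_bigr => i _; rewrite rmorphXn.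
Qed.

(** The lifting of sums needs a non-zero term, so the residue 0 is written as
    1 + (-1); this is where two terms and a k-th root of -1 are used. *)
Lemma is_waring_lift b : (1 < b)%N -> (exists z : F, z ^+ k = - 1) ->
  is_waring F k b -> is_waring R k b.
Proof.
move=> b1 [z zE] [cov min]; split=> [r|s /cover_residue/min //].
have k0 : (0 < k)%N by rewrite lt0n; apply: contraNneq k_neq0 => ->.
have [pi_r0|pi_r0] := eqVneq (pi r) 0.
  pose i0 := Ordinal (ltnW b1); pose i1 := Ordinal b1.
  apply: (@lift_sum_powers _
    (fun i => if i == i0 then 1 else if i == i1 then z else 0) _ i0).
    by rewrite eqxx oner_eq0.
  rewrite pi_r0 (bigD1 i0) // (bigD1 i1) //= big1.
    by rewrite expr1n zE addr0 subrr.
  by move=> i /andP[/negPf -> /negPf ->]; rewrite expr0n eqn0Ngt k0.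
have [x xE] := cov (pi r).
have [i0 xi0] : exists i, x i != 0.
  apply/existsP; apply: contraNT pi_r0 => /existsPn x0.
  rewrite -xE big1 // => i _; move/negPn/eqP: (x0 i) => ->.
  by rewrite expr0n eqn0Ngt k0.
exact: lift_sum_powers xi0 xE.
Qed.

End Lifting.

Lemma is_waring_exponent1 (R : finComNzRingType) : is_waring R 1 1.
Proof.
split=> [r|s cov]; first by exists (fun=> r); rewrite big_ord1 GRing.expr1.
rewrite lt0n; apply/negP => /eqP s0; move: cov; rewrite s0 => /(_ 1%R)[x].
by rewrite big_ord0 => /eqP; rewrite eq_sym GRing.oner_eq0.
Qed.

(** * The Waring number of the local ring *)

Section Star.
Variables (p a b : nat) (R : finComNzRingType) (m : {set R}).
Hypotheses (p_pr : prime p) (a_gt0 : 0 < a) (b_gt0 : 0 < b).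
Hypotheses (m_local : local_ring m).
Hypothesis card_residue : #|residue_classes m| = p ^ (a * b).

Local Notation Q := (p ^ a).

Let Q_gt1 : 1 < Q.
Proof. by rewrite -(exp1n a) ltn_exp2r ?prime_gt1. Qed.

Lemma waring_exponentE : waring_exponent p a b = repunit Q b %/ b.
Proof.
rewrite /waring_exponent expnM (expn_sub1 Q b) mulnC.
by rewrite divnMr // subn_gt0.
Qed.

Lemma waring_exponent_integralE :
  waring_exponent_integral p a b = (b %| repunit Q b).
Proof.
rewrite /waring_exponent_integral expnM (expn_sub1 Q b) [b * _]mulnC.
by rewrite dvdn_pmul2l // subn_gt0.
Qed.

Lemma star_of_generation : b %| repunit Q b ->
  waring_exists R (waring_exponent p a b) \/
    (forall d, b %| repunit Q d -> b %| d) ->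
  star p a b R.
Proof.
move=> b_rep gen.
suff waring_k : is_waring R (waring_exponent p a b) b.
  split=> //; first by rewrite waring_exponent_integralE.
  by under eq_bigr do rewrite expnM; rewrite -/(repunit Q b) -waring_exponentE.
have [b1|b1] := eqVneq b 1.
  rewrite waring_exponentE b1 /repunit big_ord1; exact: is_waring_exponent1.
rewrite !waring_exponentE in gen *.
have /esym bk := divnK b_rep; rewrite mulnC in bk.
set k := _ %/ b in gen bk *.
have [F [pi [pi_surj pi_unit cardF]]] := residue_field m_local.
rewrite card_residue expnM in cardF.
have k0 := power_exponent_neq0 p_pr a_gt0 b_gt0 cardF bk.
apply: (is_waring_lift pi_surj pi_unit k0).
- by rewrite ltn_neqAle eq_sym b1.
- exact: opp1_power p_pr a_gt0 b_gt0 cardF bk.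
apply: (field_waring p_pr a_gt0 b_gt0 cardF bk).
case: gen => [[s [cov _]]|gen]; [left; exists s | by right].
exact: cover_residue cov.
Qed.

Lemma star_if_definedP : b %| repunit Q b -> star_if_defined p a b R.
Proof.
move=> b_rep; split; first by rewrite waring_exponent_integralE.
by move=> ex; apply: star_of_generation => //; left.
Qed.

(** When Q = 1 modulo the prime factors of b, divisibility by b is automatic,
    and only a factor 4 of b can prevent the k-th powers from generating F. *)
Lemma star_of_primes :
  (forall r, prime r -> r %| b -> Q = 1 %[mod r]) ->
  star_if_defined p a b R /\ ((4 %| b -> Q = 1 %[mod 4]) -> star p a b R).
Proof.
move=> Qr; have b_rep := dvdn_repunit Q_gt1 b_gt0 Qr.
split=> [|Q4]; first exact: star_if_definedP.
by apply: star_of_generation => //; right=> d; apply: repunit_dvdn.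
Qed.

End Star.

(** * Arithmetic of the exponent conditions *)

(** Raising to the power r is the identity modulo r. *)
Lemma expn_fermat_mod1 x b c r : prime r -> b = r * c ->
  x ^ b = 1 %[mod r] -> x ^ c = 1 %[mod r].
Proof. by move=> r_pr ->; rewrite mulnC expnM (fermat_little (x ^ c) r_pr). Qed.

Lemma prime_dvd_primeM r s s' : prime r -> prime s -> prime s' ->
  r %| s * s' -> r = s \/ r = s'.
Proof.
move=> r_pr s_pr s'_pr; rewrite Euclid_dvdM // !dvdn_prime2 //.
by case/orP=> /eqP ->; [left | right].
Qed.

Lemma prime_dvd_prodX l (r t : 'I_l -> nat) s : prime s ->
  (forall i, prime (r i)) -> s %| \prod_(i < l) r i ^ t i ->
  exists i, s = r i.
Proof.
move=> s_pr r_pr; rewrite Euclid_dvd_prod // big_has => /hasP[i _ /=].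
by rewrite Euclid_dvdX // dvdn_prime2 // => /andP[/eqP -> _]; exists i.
Qed.

Lemma expn_prime_power_mod1 x r h : prime r ->
  x ^ (r ^ h) = 1 %[mod r] -> x = 1 %[mod r].
Proof.
move=> r_pr; elim: h => [|h IHh] //.
by rewrite expnS => /(expn_fermat_mod1 r_pr erefl).
Qed.

(** Either Q = 1 modulo r and the sum is b = 0, or r divides Q ^ b - 1, which is
    Q - 1 times the sum, without dividing Q - 1. *)
Lemma prime_dvd_repunit Q r b : 0 < Q -> prime r -> r %| b ->
  Q ^ b = 1 %[mod r] -> r %| repunit Q b.
Proof.
move=> Q0 r_pr rb /eqP; rewrite eqn_mod_dvd ?expn_gt0 ?Q0 // expn_sub1.
rewrite Euclid_dvdM // -eqn_mod_dvd // => /orP[/eqP Q1|//].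
by rewrite /dvdn (repunit_mod1 b Q1).
Qed.

Lemma coprime_prodl (I : Type) (s : seq I) (P : pred I) (f : I -> nat) n :
  (forall i, P i -> coprime (f i) n) -> coprime (\prod_(i <- s | P i) f i) n.
Proof.
by move=> f_cop; elim/big_ind: _ => // [|x y xn yn];
   rewrite ?coprime1n // coprimeMl xn.
Qed.

Lemma dvdn_prod_coprime (I : eqType) (s : seq I) (f : I -> nat) n :
  uniq s -> (forall i j, i != j -> coprime (f i) (f j)) ->
  (forall i, f i %| n) -> \prod_(i <- s) f i %| n.
Proof.
move=> s_uniq f_cop f_dvd; elim: s s_uniq => [_|i s IHs /= /andP[i_s s_uniq]].
  by rewrite big_nil dvd1n.
rewrite big_cons Gauss_dvd ?f_dvd ?IHs // coprime_sym.
rewrite big_seq; apply: coprime_prodl => j js; apply: f_cop.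
by apply: contraNneq i_s => <-.
Qed.

(** The way in which an ordering of the primes enters: s is too large to divide
    the order of the unit group modulo r. *)
Lemma coprime_prime_pred r s : prime r -> prime s -> r < s -> coprime s (r - 1).
Proof.
move=> r_pr s_pr rs; rewrite prime_coprime //; apply/negP => /dvdn_leq.
by have := prime_gt1 r_pr; lia.
Qed.

Lemma mult_order_prime_power Q r t h : prime r -> h < t ->
  is_mult_order (r ^ t) Q (r ^ h) -> Q = 1 %[mod r].
Proof.
move=> r_pr ht [_ Qh _].
have {Qh} : Q ^ (r ^ h) = 1 %[mod r].
  have r_t : r %| r ^ t by rewrite dvdn_exp // (leq_ltn_trans _ ht).
  by rewrite -(modn_dvdm (Q ^ _) r_t) Qh modn_dvdm.
exact: expn_prime_power_mod1.
Qed.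

Lemma dvdn_repunit_prime_power Q r t : 1 < Q -> prime r -> Q = 1 %[mod r] ->
  r ^ t %| repunit Q (r ^ t).
Proof.
move=> Q1 r_pr Qr; apply: dvdn_repunit => //.
  by rewrite expn_gt0 prime_gt0.
move=> s s_pr; rewrite Euclid_dvdX // dvdn_prime2 // => /andP[/eqP -> _].
exact: Qr.
Qed.

Lemma mult_order_exists Q n e : 0 < e -> Q ^ e = 1 %[mod n] ->
  exists2 d, d %| e & is_mult_order n Q d.
Proof.
move=> e0 Qe.
have ex : exists d, (0 < d) && (Q ^ d == 1 %[mod n]).
  by exists e; rewrite e0; apply/eqP.
have [d /andP[d0 /eqP Qd] d_min] := ex_minnP ex.
have d_order : forall f, 0 < f -> Q ^ f = 1 %[mod n] -> d <= f.
  by move=> f f0 Qf; apply: d_min; rewrite f0; apply/eqP.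
exists d; last by split.
have := d_order (gcdn d e); rewrite gcdn_gt0 d0.
move=> /(_ isT (expn_gcd_mod1 d0 Qd Qe)).
move=> d_gcd; suff -> : d = gcdn d e by apply: dvdn_gcdr.
by apply/eqP; rewrite eqn_leq d_gcd dvdn_leq ?dvdn_gcdl.
Qed.

(** * The conditions on p ^ a *)

Theorem theorem6p2 :
  forall (p a b : nat), prime p -> 0 < a -> 0 < b ->
  forall (R : finComNzRingType) (m : {set R}),
  local_ring m -> #|residue_classes m| = p ^ (a * b) ->
  [/\ (* first assertion *)
      b %| (p ^ (a * b) - 1) %/ (p ^ a - 1) -> star_if_defined p a b R,

      (* sufficient conditions *)
      [/\ (* (a) *)
          prime b -> b != p ->
            p ^ a = 1 %[mod b] -> star p a b R,
          (* (b) *)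
          forall r : nat, prime r -> odd r -> b = 2 * r ->
            coprime (p ^ a) b ->
            (p ^ a = 1 %[mod r] -> star p a b R)
            /\ (p ^ a + 1 = 0 %[mod r] -> star_if_defined p a b R)
        & (* (c) *)
          forall r r' : nat, prime r -> prime r' -> odd r -> odd r' ->
            r < r' -> ~~ (r %| r' - 1) -> b = r * r' ->
            p ^ a = 1 %[mod r * r'] -> star p a b R],
      [/\ (* (d) *)
          forall (l : nat) (r : 'I_l.+1 -> nat), increasing_primes r ->
            (forall i, r i != p) -> b = \prod_(i < l.+1) r i ->
            p ^ a = 1 %[mod r ord0] ->
            (forall i, i != ord0 -> (p ^ a) ^ (b %/ r i) = 1 %[mod r i]) ->
            star_if_defined p a b R,
          (* (e) *)
          forall r t h : nat, prime r -> b = r ^ t ->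
            h < t -> is_mult_order b (p ^ a) (r ^ h) ->
            star_if_defined p a b R
            /\ ((4 %| b -> p ^ a = 1 %[mod 4]) -> star p a b R)
        & (* (f) *)
          forall (l : nat) (r t h : 'I_l.+1 -> nat), increasing_primes r ->
            (forall i, r i != p) -> b = \prod_(i < l.+1) r i ^ t i ->
            (forall i, h i < t i) ->
            (forall i, is_mult_order (r i ^ t i) (p ^ a) (r i ^ h i)) ->
            star_if_defined p a b R
            /\ ((4 %| b -> p ^ a = 1 %[mod 4]) -> star p a b R)]
    & (* necessary conditions *)
      star_if_defined p a b R ->
      [/\ (* (a) *)
          prime b -> b != p -> p ^ a = 1 %[mod b],
          (* (b) *)
          forall r : nat, prime r -> odd r -> b = 2 * r ->
            coprime (p ^ a) b
            /\ (p ^ a = 1 %[mod r] \/ p ^ a + 1 = 0 %[mod r]),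
          (* (c) *)
          forall r r' : nat, prime r -> prime r' -> odd r -> odd r' ->
            r < r' -> ~~ (r %| r' - 1) -> b = r * r' ->
            p ^ a = 1 %[mod r * r'],
          (* (d) *)
          forall (l : nat) (r : 'I_l.+1 -> nat), increasing_primes r ->
            (forall i, r i != p) -> b = \prod_(i < l.+1) r i ->
            p ^ a = 1 %[mod r ord0]
            /\ (forall i, i != ord0 -> (p ^ a) ^ (b %/ r i) = 1 %[mod r i])
        & (* (e) *)
          forall r t : nat, prime r -> 0 < t -> b = r ^ t ->
            exists2 h : nat, h < t & is_mult_order b (p ^ a) (r ^ h)]].

Proof.
move=> p a b p_pr a_gt0 b_gt0 R m m_local card_residue.
set Q := p ^ a.
have Q_gt1 : 1 < Q by rewrite /Q -(exp1n a) ltn_exp2r ?prime_gt1.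
have Q_gt0 n : 0 < Q ^ n by rewrite expn_gt0 ltnW.
have Qb_rep : Q ^ b - 1 = (Q - 1) * repunit Q b := expn_sub1 Q b.
have some_star : b %| repunit Q b -> star_if_defined p a b R.
  exact: star_if_definedP p_pr a_gt0 b_gt0 m_local card_residue.
have primes_star := star_of_primes p_pr a_gt0 b_gt0 m_local card_residue.
have squarefree_star : (forall r, prime r -> r %| b -> Q = 1 %[mod r]) ->
    ~~ (4 %| b) -> star p a b R.
  by move=> Qr b4; apply: (primes_star Qr).2 => /(negP b4).
have order_star l (r t h : 'I_l.+1 -> nat) :
  increasing_primes r -> b = \prod_(i < l.+1) r i ^ t i ->
  (forall i, h i < t i) ->
  (forall i, is_mult_order (r i ^ t i) Q (r i ^ h i)) ->
  star_if_defined p a b R /\ ((4 %| b -> Q = 1 %[mod 4]) -> star p a b R).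
- move=> [r_pr _] bE ht ord_r; apply: primes_star => s s_pr.
  rewrite bE => /(prime_dvd_prodX s_pr r_pr)[i ->].
  exact: mult_order_prime_power (r_pr i) (ht i) (ord_r i).
split.
- rewrite expnM Qb_rep mulKn ?subn_gt0 //.
- split.
  + move=> b_pr _ Qb; apply: squarefree_star.
      by move=> r r_pr; rewrite dvdn_prime2 // => /eqP ->.
    apply/negP => b4; have : 2 %| b by apply: dvdn_trans b4.
    by rewrite dvdn_prime2 // => /eqP b2; move: b4; rewrite -b2.
  + move=> r r_pr r_odd bE Q_cop.
    have Q_odd : odd Q.
      by move: Q_cop; rewrite bE coprimeMr coprimen2 => /andP[].
    split=> [Qr|Qr].
      apply: squarefree_star => [s s_pr|]; last by rewrite bE; lia.
      rewrite bE => /(prime_dvd_primeM s_pr (isT : prime 2) r_pr)[] -> //.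
      by rewrite modn2 Q_odd.
    (* N is a multiple of 1 + Q, which is even and divisible by r. *)
    apply: some_star; rewrite {2}bE repunitM // dvdn_mulr //.
    rewrite /repunit 2!big_ord_recl big_ord0 /= expn0 expn1 addn0.
    rewrite bE Gauss_dvd ?coprime2n // /dvdn addnC Qr mod0n eqxx andbT.
    by rewrite -/(dvdn _ _) dvdn2 addn1 /= Q_odd.
  move=> r r' r_pr r'_pr r_odd r'_odd _ _ bE Qrr'.
  apply: squarefree_star => [s s_pr|]; last first.
    rewrite bE; apply/negP => /(dvdn_trans (isT : 2 %| 4)).
    by rewrite dvdn2 oddM r_odd r'_odd.
  rewrite bE => s_rr'.
  by rewrite -(modn_dvdm Q s_rr') Qrr' modn_dvdm.
- split.
  + move=> l r [r_pr r_inc] r_p bE Q0 Qi; apply: some_star.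
    have r_b i : r i %| b by rewrite bE (bigD1 i) // dvdn_mulr.
    rewrite {1}bE; apply: dvdn_prod_coprime => [|i j ij|i].
    * exact: index_enum_uniq.
    * rewrite prime_coprime ?dvdn_prime2 //; apply/eqP => rij.
      case: (ltngtP i j) => [/r_inc|/r_inc|/val_inj/eqP].
      - by rewrite rij ltnn.
      - by rewrite rij ltnn.
      - by rewrite (negPf ij).
    apply: prime_dvd_repunit; rewrite ?(ltnW Q_gt1) //.
    have [->|i0] := eqVneq i ord0; first exact: expn_mod1.
    by rewrite -(divnK (r_b i)) expnM expn_mod1 ?Qi.
  + move=> r t h r_pr bE ht ord_b; apply: primes_star => s s_pr.
    rewrite bE Euclid_dvdX // dvdn_prime2 // => /andP[/eqP -> _].
    by apply: (mult_order_prime_power r_pr ht); rewrite -bE.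
  by move=> l r t h r_inc _; apply: order_star.
case=> b_int _; have {b_int} b_rep : b %| repunit Q b.
  by rewrite -waring_exponent_integralE.
have Qb : Q ^ b = 1 %[mod b].
  by apply/eqP; rewrite eqn_mod_dvd // Qb_rep dvdn_mull.
have Qb_dvd r : r %| b -> Q ^ b = 1 %[mod r].
  by move=> rb; rewrite -(modn_dvdm (Q ^ b) rb) Qb modn_dvdm.
have root1 r c : prime r -> b = r * c -> Q ^ c = 1 %[mod r].
  move=> r_pr bE; apply: (expn_fermat_mod1 r_pr bE); apply: Qb_dvd.
  by rewrite bE dvdn_mulr.
split.
- by move=> b_pr _; have := root1 b 1 b_pr (esym (muln1 b)); rewrite expn1.
- move=> r r_pr r_odd bE.
  split; first exact: coprime_dvdr b_rep (coprime_repunit Q b_gt0).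
  have /eqP := root1 r 2 r_pr (etrans bE (mulnC 2 r)).
  rewrite eqn_mod_dvd // -[1](exp1n 2) subn_sqr.
  rewrite Euclid_dvdM // -eqn_mod_dvd ?(ltnW Q_gt1) //.
  by case/orP=> [/eqP|/eqP Qr]; [left | right; rewrite Qr mod0n].
- move=> r r' r_pr r'_pr r_odd r'_odd rr' r_ndvd bE.
  have Qr := root1 r r' r_pr bE.
  have Qr' := root1 r' r r'_pr (etrans bE (mulnC r r')).
  have r_r' : coprime r r'.
    by rewrite prime_coprime // dvdn_prime2 // neq_ltn rr'.
  apply/eqP; rewrite chinese_remainder //; apply/andP; split; apply/eqP.
    apply: (expn_coprime_mod1 r_pr _ _ Qr); first exact: prime_gt0.
    exact: coprime_prime_pred.
  apply: (expn_coprime_mod1 r'_pr _ _ Qr'); first exact: prime_gt0.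
  by rewrite prime_coprime.
- move=> l r [r_pr r_inc] r_p bE.
  have Qi i : Q ^ (\prod_(j < l.+1 | j != i) r j) = 1 %[mod r i].
    by apply: root1; rewrite // bE (bigD1 i).
  split=> [|i _]; last by rewrite {1}bE (bigD1 i) //= mulKn ?prime_gt0.
  apply: (expn_coprime_mod1 (r_pr ord0) _ _ (Qi ord0)).
    by rewrite prodn_gt0 // => j; apply: prime_gt0.
  apply: coprime_prodl => j j0; apply: coprime_prime_pred => //.
  by apply: r_inc; rewrite lt0n.
move=> r [//|t] r_pr _ bE.
have Qr : Q = 1 %[mod r].
  apply: (expn_prime_power_mod1 (h := t.+1) r_pr); rewrite -bE; apply: Qb_dvd.
  by rewrite bE dvdn_exp.
(* Q ^ (r ^ t) - 1 is Q - 1, divisible by r, times a sum divisible by r ^ t. *)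
have Q_t : Q ^ (r ^ t) = 1 %[mod b].
  apply/eqP; rewrite eqn_mod_dvd // expn_sub1 bE expnS.
  rewrite dvdn_mul ?dvdn_repunit_prime_power //.
  by rewrite -eqn_mod_dvd ?(ltnW Q_gt1) //; apply/eqP.
have r_t : 0 < r ^ t by rewrite expn_gt0 prime_gt0.
have [d /(dvdn_pfactor _ _ r_pr)[h ht ->] ord_d] := mult_order_exists r_t Q_t.
by exists h.
Qed.
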